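(* Let $(\{R_i\}_{i\geq 0},\{t_i\}_{i\geq 0})$ be a perfectoid tower arising from some pair $(R,I_0)$, and let $(\{R^{s.\flat}_{i}\}_{i\geq 0},\{t^{s.\flat}_{i}\}_{i\geq 0})$ be its tilt associated to $(R,I_0)$. Then $(\{R_{i}^{s.\flat}\}_{i\geq 0},\{t_{i}^{s.\flat}\}_{i\geq 0})$ is a perfectoid tower arising from $(R_0^{s.\flat},I^{s.\flat}_0)$.
   Context: Fix a prime $p$. All rings are commutative and unital. A pair $(R,I_0)$ is a ring with an ideal. A tower of rings $(\{R_i\}_{i\ge 0},\{t_i\}_{i\ge 0})$ is a sequence of rings with ring maps $t_i:R_i\to R_{i+1}$; each $R_i$ is an algebra over $R_j$ ($j\le i$) via these maps. Torsion: for an ideal $I$ of a ring $A$ and an $A$-module $M$, $M_{I\text{-tor}}$ is the submodule of those $m\in M$ such that for every $x\in I$ there is $n>0$ with $x^nm=0$. Purely inseparable tower arising from $(R,I_0)$: (a) $R_0=R$ and $p\in I_0$; (b) for each $i\ge0$ the map $\overline{t_i}:R_i/I_0R_i\to R_{i+1}/I_0R_{i+1}$ induced by $t_i$ is injective; (c) for each $i\ge0$ the image of the Frobenius endomorphism of $R_{i+1}/I_0R_{i+1}$ is contained in the image of $\overline{t_i}$. Write $\overline{R_i}:=R_i/I_0R_i$. The $i$-th Frobenius projection is the unique ring map $F_i:\overline{R_{i+1}}\to\overline{R_i}$ such that $\overline{t_i}\circ F_i$ is the Frobenius endomorphism of $\overline{R_{i+1}}$. Perfectoid tower arising from $(R,I_0)$: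 a purely inseparable tower arising from $(R,I_0)$ such that moreover: (d) every $F_i$ is surjective; (e) every $I_0R_i$ is contained in the Jacobson radical of $R_i$; (f) $I_0$ is principal, and $R_1$ contains a principal ideal $I_1$ with (f-1) $I_1^p=I_0R_1$ and (f-2) $\ker(F_i)=I_1\overline{R_{i+1}}$ for every $i\ge0$; (g) for every $i\ge0$, $I_0(R_i)_{I_0\text{-tor}}=(0)$, and there is a (unique) bijection $(F_i)_{\mathrm{tor}}:(R_{i+1})_{I_0\text{-tor}}\to(R_i)_{I_0\text{-tor}}$ compatible with $F_i$ under the natural maps $(R_k)_{I_0\text{-tor}}\hookrightarrow R_k\twoheadrightarrow\overline{R_k}$, $k=i,i+1$. Tilt: $R_j^{s.\flat}:=\varprojlim\{\cdots\xrightarrow{F_{j+1}}\overline{R_{j+1}}\xrightarrow{F_j}\overline{R_j}\}$, with $t_j^{s.\flat}:R_j^{s.\flat}\to R_{j+1}^{s.\flat}$, $(a_i)_{i\ge0}\mapsto(\overline{t_{j+i}}(a_i))_{i\ge0}$. The ideal $I_0^{s.\flat}\subseteq R_0^{s.\flat}$ is the kernel of the projection $R_0^{s.\flat}\to\overline{R_0}$, $(a_i)_{i\ge0}\mapsto a_0$. *)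

(* Defs.v *)
From HB Require Import structures.
From mathcomp Require Import all_boot all_algebra.
From mathcomp Require Import boolp classical_sets functions.

Set Implicit Arguments.
Unset Strict Implicit.
Unset Printing Implicit Defensive.

Import GRing.Theory.
Local Open Scope classical_set_scope.
Local Open Scope ring_scope.
Local Open Scope quotient_scope.

Identity Coercion set_to_fun : set >-> Funclass.

(* MathComp's [idealr] only covers proper ideals of non-trivial rings, whereas
   the unit ideal and the zero ring ([comPzRingType]) are allowed here. *)
Section Ideals.
Variable R : comPzRingType.

Definition is_ideal (I : set R) : Prop :=
  [/\ I 0, forall x y, I x -> I y -> I (x + y)
         & forall a x, I x -> I (a * x)].

Record ideal := Ideal { ideal_set :> set R; idealP : is_ideal ideal_set }.

Lemma smallest_is_ideal (S : set R) : is_ideal (smallest is_ideal S).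
Proof.
split=> [J [[J0 _ _] _] // | x y Ix Iy J HJ | a x Ix J HJ].
  by have [[_ JD _] _] := HJ; apply: JD; [exact: Ix | exact: Iy].
by have [[_ _ JM] _] := HJ; apply: JM; exact: Ix.
Qed.

Definition ideal_gen (S : set R) : ideal := Ideal (smallest_is_ideal S).

Definition principal (I : ideal) : Prop :=
  exists a : R, I = ideal_gen [set a] :> set R.

Definition ideal_mul (I J : ideal) : ideal :=
  ideal_gen [set x * y | x in I & y in J].

Definition ideal_pow (I : ideal) (n : nat) : ideal :=
  iter n (ideal_mul I) (ideal_gen setT).

Definition maximal_ideal (M : ideal) : Prop :=
  M <> setT :> set R /\
  forall J : ideal, M `<=` J -> J = M :> set R \/ J = setT :> set R.

Definition jacobson : set R :=
  [set x | forall M : ideal, maximal_ideal M -> M x].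

Definition ideal_pred (I : ideal) : {pred R} := fun x => `[< I x >].

Fact ideal_pred_zmod_closed I : zmod_closed (ideal_pred I).
Proof.
have [I0 ID IM] := idealP I; split; first exact/asboolP.
move=> x y /asboolP Ix /asboolP Iy; apply/asboolP.
by apply: ID => //; rewrite -mulN1r; exact: IM.
Qed.

HB.instance Definition _ I :=
  GRing.isZmodClosed.Build R (ideal_pred I) (ideal_pred_zmod_closed I).

End Ideals.

(* The library equips [{quot I}] with a multiplication only for the proper
   ideals of non-trivial rings; its additive quotient is reused here. *)
Section Quotient.
Variables (R : comPzRingType) (I : ideal R).

Definition quo : Type := Quotient.quot (ideal_pred I).
HB.instance Definition _ := GRing.Zmodule.on quo.

Definition quo_pi (x : R) : quo := \pi_(Quotient.quot (ideal_pred I)) x.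
Definition quo_repr (u : quo) : R :=
  repr (u : Quotient.quot (ideal_pred I)).

Lemma quo_reprK u : quo_pi (quo_repr u) = u.
Proof. exact: reprK. Qed.

Lemma quo_piP x y : quo_pi x = quo_pi y <-> I (x - y).
Proof.
split=> [/eqmodP | Ixy].
  by rewrite /= /Quotient.equiv => /asboolP.
by apply/eqmodP; rewrite /= /Quotient.equiv; exact/asboolP.
Qed.

Fact quo_piB : zmod_morphism quo_pi.
Proof.
by move=> x y; rewrite /quo_pi
  (raddfB \pi_(Quotient.quot (ideal_pred I))).
Qed.

Definition quo_one : quo := quo_pi 1.
Definition quo_mul (u v : quo) : quo := quo_pi (quo_repr u * quo_repr v).

Lemma quo_piM x y : quo_pi (x * y) = quo_mul (quo_pi x) (quo_pi y).
Proof.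
have [_ ID IM] := idealP I; apply/quo_piP.
set x' := quo_repr _; set y' := quo_repr _.
have Hx : I (x - x') by apply/quo_piP; rewrite quo_reprK.
have Hy : I (y - y') by apply/quo_piP; rewrite quo_reprK.
have -> : x * y - x' * y' = y * (x - x') + x' * (y - y').
  by rewrite !mulrBr [y * x]mulrC [y * x']mulrC addrA subrK.
by apply: ID; exact: IM.
Qed.

Fact quo_mulA : associative quo_mul.
Proof.
move=> u v w; rewrite -[u]quo_reprK -[v]quo_reprK -[w]quo_reprK.
by rewrite -!quo_piM mulrA.
Qed.
Fact quo_mulC : commutative quo_mul.
Proof. by move=> u v; rewrite /quo_mul mulrC. Qed.
Fact quo_mul1 : left_id quo_one quo_mul.
Proof. by move=> u; rewrite -[u]quo_reprK -quo_piM mul1r. Qed.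
Fact quo_mulDl : left_distributive quo_mul +%R.
Proof.
have piD x y : quo_pi (x + y) = quo_pi x + quo_pi y.
  by rewrite /quo_pi (raddfD \pi_(Quotient.quot (ideal_pred I))).
move=> u v w; rewrite -[u]quo_reprK -[v]quo_reprK -[w]quo_reprK.
by rewrite -piD -!quo_piM mulrDl piD.
Qed.

HB.instance Definition _ := GRing.Zmodule_isComPzRing.Build quo
  quo_mulA quo_mulC quo_mul1 quo_mulDl.

HB.instance Definition _ := GRing.isZmodMorphism.Build R quo quo_pi quo_piB.
HB.instance Definition _ := GRing.isMonoidMorphism.Build R quo quo_pi
  (conj (erefl _) quo_piM).

End Quotient.

Section Morphisms.
Variables (R S : comPzRingType) (f : {rmorphism R -> S}).

Definition ideal_ext (I : ideal R) : ideal S := ideal_gen (f @` I).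

Fact ker_is_ideal : is_ideal [set x | f x = 0].
Proof.
split=> [|x y /= fx fy|a x /= fx]; first exact: rmorph0.
  by rewrite rmorphD fx fy addr0.
by rewrite rmorphM fx mulr0.
Qed.

Definition ideal_ker : ideal R := Ideal ker_is_ideal.

Definition torsion (I : ideal R) : set S :=
  [set m | forall x, I x -> exists2 n : nat, (0 < n)%N & f (x ^+ n) * m = 0].

Section QuoMap.
Variables (I : ideal R) (J : ideal S) (fIJ : forall x, I x -> J (f x)).

Definition quo_map of (forall x, I x -> J (f x)) := fun u : quo I =>
  quo_pi J (f (quo_repr u)).

Lemma quo_mapE x : quo_map fIJ (quo_pi I x) = quo_pi J (f x).
Proof.
by apply/quo_piP; rewrite -rmorphB; apply/fIJ/quo_piP; rewrite quo_reprK.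
Qed.

Fact quo_map_zmod : zmod_morphism (quo_map fIJ).
Proof.
move=> u v; rewrite -[u]quo_reprK -[v]quo_reprK.
by rewrite -rmorphB !quo_mapE !rmorphB.
Qed.
Fact quo_map_monoid : monoid_morphism (quo_map fIJ).
Proof.
split=> [|u v]; first by rewrite -(rmorph1 (quo_pi I)) quo_mapE !rmorph1.
rewrite -[u]quo_reprK -[v]quo_reprK.
by rewrite -rmorphM !quo_mapE !rmorphM.
Qed.

HB.instance Definition _ :=
  GRing.isZmodMorphism.Build (quo I) (quo J) (quo_map fIJ) quo_map_zmod.
HB.instance Definition _ :=
  GRing.isMonoidMorphism.Build (quo I) (quo J) (quo_map fIJ) quo_map_monoid.
End QuoMap.

End Morphisms.

Section InverseLimit.
Variables (S : nat -> comPzRingType) (F : forall i, {rmorphism S i.+1 -> S i}).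

Record invlim := InvLim {
  lim_seq :> forall i, S i;
  lim_seqP : forall i, F i (lim_seq i.+1) = lim_seq i }.

Lemma invlimP (a b : invlim) : (forall i, a i = b i) -> a = b.
Proof.
case: a b => [a aP] [b bP] /= ab.
have {}ab : a = b by exact: functional_extensionality_dep.
by case: _ / ab bP => bP; congr InvLim; exact: Prop_irrelevance.
Qed.

HB.instance Definition _ := gen_eqMixin invlim.
HB.instance Definition _ := gen_choiceMixin invlim.

Program Definition lim_zero := @InvLim (fun=> 0) _.
Next Obligation. by rewrite rmorph0. Qed.
Program Definition lim_one := @InvLim (fun=> 1) _.
Next Obligation. by rewrite rmorph1. Qed.
Program Definition lim_opp (a : invlim) := @InvLim (fun i => - a i) _.
Next Obligation. by rewrite rmorphN lim_seqP. Qed.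
Program Definition lim_add (a b : invlim) := @InvLim (fun i => a i + b i) _.
Next Obligation. by rewrite rmorphD !lim_seqP. Qed.
Program Definition lim_mul (a b : invlim) := @InvLim (fun i => a i * b i) _.
Next Obligation. by rewrite rmorphM !lim_seqP. Qed.

Fact lim_addA : associative lim_add.
Proof. by move=> a b c; apply: invlimP => i /=; rewrite addrA. Qed.
Fact lim_addC : commutative lim_add.
Proof. by move=> a b; apply: invlimP => i /=; rewrite addrC. Qed.
Fact lim_add0 : left_id lim_zero lim_add.
Proof. by move=> a; apply: invlimP => i /=; rewrite add0r. Qed.
Fact lim_addN : left_inverse lim_zero lim_opp lim_add.
Proof. by move=> a; apply: invlimP => i /=; rewrite addNr. Qed.
Fact lim_mulA : associative lim_mul.
Proof. by move=> a b c; apply: invlimP => i /=; rewrite mulrA. Qed.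
Fact lim_mulC : commutative lim_mul.
Proof. by move=> a b; apply: invlimP => i /=; rewrite mulrC. Qed.
Fact lim_mul1 : left_id lim_one lim_mul.
Proof. by move=> a; apply: invlimP => i /=; rewrite mul1r. Qed.
Fact lim_mulDl : left_distributive lim_mul lim_add.
Proof. by move=> a b c; apply: invlimP => i /=; rewrite mulrDl. Qed.

HB.instance Definition _ := GRing.isZmodule.Build invlim
  lim_addA lim_addC lim_add0 lim_addN.
HB.instance Definition _ := GRing.Zmodule_isComPzRing.Build invlim
  lim_mulA lim_mulC lim_mul1 lim_mulDl.

Definition lim_proj (k : nat) (a : invlim) : S k := a k.

HB.instance Definition _ k :=
  GRing.isZmodMorphism.Build invlim (S k) (lim_proj k) (fun _ _ => erefl).
HB.instance Definition _ k :=
  GRing.isMonoidMorphism.Build invlim (S k) (lim_proj k)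
    (conj erefl (fun _ _ => erefl)).

End InverseLimit.

Section InverseLimitMap.
Variables (S S' : nat -> comPzRingType).
Variables (F : forall i, {rmorphism S i.+1 -> S i}).
Variables (F' : forall i, {rmorphism S' i.+1 -> S' i}).
Variables (g : forall i, {rmorphism S i -> S' i}).
Hypothesis gF : forall i x, F' i (g i.+1 x) = g i (F i x).

Program Definition lim_map (a : invlim F) : invlim F' :=
  @InvLim S' F' (fun i => g i (a i)) _.
Next Obligation. by rewrite gF lim_seqP. Qed.

Fact lim_map_zmod : zmod_morphism lim_map.
Proof. by move=> a b; apply: invlimP => i /=; rewrite rmorphB. Qed.
Fact lim_map_monoid : monoid_morphism lim_map.
Proof.
by split=> [|a b]; apply: invlimP => i /=; rewrite ?rmorph1 ?rmorphM.
Qed.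

HB.instance Definition _ := GRing.isZmodMorphism.Build
  (invlim F) (invlim F') lim_map lim_map_zmod.
HB.instance Definition _ := GRing.isMonoidMorphism.Build
  (invlim F) (invlim F') lim_map lim_map_monoid.
End InverseLimitMap.

(* The index [j + i] is written with the tail-recursive addition
   ([j.+1 + i] reduces to [j + i.+1], see [NatTrec.addE]), so that no type
   cast between [S (j.+1 + i)] and [S (j + i.+1)] is needed.  [down_from j i]
   is [F (j + i)] and [up_from j i] is [t (j + i)]. *)
Section From.
Variables (S : nat -> comPzRingType).
Variables (t : forall i, {rmorphism S i -> S i.+1}).
Variables (F : forall i, {rmorphism S i.+1 -> S i}).

Fixpoint down_from j :
    forall i, {rmorphism S (NatTrec.add j i.+1) -> S (NatTrec.add j i)} :=
  match j with
  | 0 => F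
  | j'.+1 => fun i => down_from j' i.+1
  end.

Fixpoint up_from j :
    forall i, {rmorphism S (NatTrec.add j i) -> S (NatTrec.add j.+1 i)} :=
  match j with
  | 0 => t
  | j'.+1 => fun i => up_from j' i.+1
  end.

Lemma from_comm : (forall i x, F i.+1 (t i.+1 x) = t i (F i x)) ->
  forall j i x, down_from j.+1 i (up_from j i.+1 x) = up_from j i (down_from j i x).
Proof. by move=> tF; elim=> [|j IHj] i x; [exact: tF | exact: IHj]. Qed.
End From.

Record tower := Tower {
  tower_ring :> nat -> comPzRingType;
  tower_map : forall i, {rmorphism tower_ring i -> tower_ring i.+1} }.

Fixpoint base_map (T : tower) i : {rmorphism T 0%N -> T i} :=
  match i with
  | 0 => idfun
  | i'.+1 => tower_map T i' \o base_map T i'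
  end.

Definition tower_tail (T : tower) : tower :=
  @Tower (fun i => T i.+1) (fun i => tower_map T i.+1).

Section TowerModIdeal.
Variables (T : tower) (I0 : ideal (T 0%N)).

Definition tower_ideal i : ideal (T i) := ideal_ext (base_map T i) I0.

Definition tower_bar i : comPzRingType := quo (tower_ideal i).

Definition tower_pi i : {rmorphism T i -> tower_bar i} :=
  quo_pi (tower_ideal i).

Lemma tower_map_ideal i x :
  tower_ideal i x -> tower_ideal i.+1 (tower_map T i x).
Proof.
move=> Ix; have [J0 JD JM] := idealP (tower_ideal i.+1).
apply: (Ix [set y | tower_ideal i.+1 (tower_map T i y)]); split.
- split=> [|y z|a y] /=; rewrite ?rmorph0 ?rmorphD ?rmorphM //; first exact: JD.
  exact: JM.
- by move=> _ [y Iy <-]; apply: sub_gen_smallest; exists y.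
Qed.

Definition tower_map_bar i : {rmorphism tower_bar i -> tower_bar i.+1} :=
  quo_map (@tower_map_ideal i).

Definition tower_torsion i : set (T i) := torsion (base_map T i) I0.

End TowerModIdeal.

Arguments tower_torsion {T} I0 i _.

(* The condition [R_0 = R] is built in: the pair is [(T 0, I0)]. *)
Record purely_inseparable (p : nat) (T : tower) (I0 : ideal (T 0%N)) : Prop := {
  pi_p : I0 p%:R;
  pi_inj : forall i, injective (tower_map_bar I0 i);
  pi_frob : forall i,
    range (fun x : tower_bar I0 i.+1 => x ^+ p) `<=` range (tower_map_bar I0 i)
}.

Arguments purely_inseparable p T I0 : clear implicits.

Section FrobeniusProjection.
Variables (p : nat) (p_pr : prime p) (T : tower) (I0 : ideal (T 0%N)).
Hypothesis piT : purely_inseparable p T I0.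

Lemma frob_proj_ex i (x : tower_bar I0 i.+1) :
  exists y : tower_bar I0 i, tower_map_bar I0 i y = x ^+ p.
Proof.
have [|y _ yx] := @pi_frob _ _ _ piT i (x ^+ p); first by exists x.
by exists y.
Qed.

Definition frob_proj_fun of prime p :=
  fun i (x : tower_bar I0 i.+1) => projT1 (cid (frob_proj_ex x)).

Lemma frob_proj_funP i x :
  tower_map_bar I0 i (frob_proj_fun p_pr x) = x ^+ p.
Proof. by rewrite /frob_proj_fun; case: cid. Qed.

Lemma tower_bar_p i : p%:R = 0 :> tower_bar I0 i.
Proof.
rewrite -(rmorph_nat (tower_pi I0 i)) -(rmorph0 (tower_pi I0 i)).
apply/quo_piP; rewrite subr0 -(rmorph_nat (base_map T i)).
by apply: sub_gen_smallest; exists p%:R => //; exact: pi_p.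
Qed.

Lemma tower_bar_exprD i (x y : tower_bar I0 i) :
  (x + y) ^+ p = x ^+ p + y ^+ p.
Proof.
have defp := prednK (prime_gt0 p_pr).
rewrite exprDn big_ord_recr subnn -defp big_ord_recl /= defp.
rewrite subn0 mulr1 mul1r bin0 binn big1 ?addr0 // => k _.
have /dvdnP[c ->] : (p %| 'C(p, bump 0 k))%N.
  by apply: prime_dvd_bin => //=; rewrite -{2}defp /bump leq0n add1n !ltnS ltn_ord.
by rewrite mulrnA -mulr_natl tower_bar_p mul0r.
Qed.

Fact frob_proj_zmod i : zmod_morphism (@frob_proj_fun p_pr i).
Proof.
move=> x y; apply: (pi_inj piT); rewrite rmorphB !frob_proj_funP.
by apply: (canRL (addrK _)); rewrite -tower_bar_exprD subrK.
Qed.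
Fact frob_proj_monoid i : monoid_morphism (@frob_proj_fun p_pr i).
Proof.
split=> [|x y]; apply: (pi_inj piT).
  by rewrite frob_proj_funP rmorph1 expr1n.
by rewrite rmorphM !frob_proj_funP exprMn.
Qed.

HB.instance Definition _ i := GRing.isZmodMorphism.Build
  (tower_bar I0 i.+1) (tower_bar I0 i) (@frob_proj_fun p_pr i)
  (@frob_proj_zmod i).
HB.instance Definition _ i := GRing.isMonoidMorphism.Build
  (tower_bar I0 i.+1) (tower_bar I0 i) (@frob_proj_fun p_pr i)
  (@frob_proj_monoid i).

Definition frob_proj i : {rmorphism tower_bar I0 i.+1 -> tower_bar I0 i} :=
  @frob_proj_fun p_pr i.

Lemma frob_projP i x : tower_map_bar I0 i (frob_proj i x) = x ^+ p.
Proof. exact: frob_proj_funP. Qed.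

Lemma frob_proj_unique i (G : {rmorphism tower_bar I0 i.+1 -> tower_bar I0 i}) :
  (forall x, tower_map_bar I0 i (G x) = x ^+ p) -> G =1 frob_proj i.
Proof. by move=> GP x; apply: (pi_inj piT); rewrite GP frob_projP. Qed.

Lemma frob_proj_comm i x :
  frob_proj i.+1 (tower_map_bar I0 i.+1 x) = tower_map_bar I0 i (frob_proj i x).
Proof. by apply: (pi_inj piT); rewrite !frob_projP rmorphXn. Qed.

Definition tilt_ring (j : nat) : comPzRingType :=
  invlim (down_from frob_proj j).

Definition tilt_map (j : nat) : {rmorphism tilt_ring j -> tilt_ring j.+1} :=
  lim_map (from_comm frob_proj_comm (j := j)).

Definition tilt : tower := Tower tilt_map.

Definition tilt_proj0 : {rmorphism tilt 0%N -> tower_bar I0 0%N} :=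
  lim_proj (F := frob_proj) 0%N.

Definition tilt_ideal : ideal (tilt 0%N) := ideal_ker tilt_proj0.

End FrobeniusProjection.

Record perfectoid (p : nat) (p_pr : prime p) (T : tower) (I0 : ideal (T 0%N)) :
    Prop := {
  perf_pi : purely_inseparable p T I0;
  perf_surj : forall i, set_surj setT setT (frob_proj p_pr perf_pi i);
  perf_jac : forall i, tower_ideal I0 i `<=` @jacobson (T i);
  perf_principal : principal I0;
  perf_I1 : exists I1 : ideal (T 1%N),
    [/\ principal I1,
        ideal_pow I1 p = tower_ideal I0 1%N :> set (T 1%N)
      & forall i, ideal_ker (frob_proj p_pr perf_pi i) =
          ideal_ext (tower_pi I0 i.+1 \o base_map (tower_tail T) i) I1
            :> set (tower_bar I0 i.+1)];
  perf_tor0 : forall i x m,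
    I0 x -> tower_torsion I0 i m -> base_map T i x * m = 0;
  perf_tor_bij : forall i, exists Ftor : T i.+1 -> T i,
    set_bij (tower_torsion I0 i.+1) (tower_torsion I0 i) Ftor /\
    forall m, tower_torsion I0 i.+1 m ->
      tower_pi I0 i (Ftor m) = frob_proj p_pr perf_pi i (tower_pi I0 i.+1 m)
}.

Arguments perfectoid {p} p_pr T I0.

(* Main.v *)
(* Write [A_i] for the reduction of [R_i] modulo [I_0].  Dropping the first
   coordinate is an isomorphism from the [j]-th tilt onto the [(j+1)]-st, under
   which [t_j] becomes the Frobenius; so the tilt is the perfect tower over a
   reduced ring, and the inverse isomorphism [(b_i) |-> (F_j b_0, b_0, b_1, ...)]
   lifts its Frobenius projections and identifies its torsion parts.  The point
   is that the kernel of the projection of the [j]-th tilt to [A_j] is generated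
   by any [g] in the [0]-th tilt whose coordinate in [A_1] is the class of a
   generator of [I_1]: then [g_(i+1) ^ (p^i)] generates [ker F_i], and
   [g_i ^ (p^i) = 0], so successive approximation converges. *)
Require Import Defs.
From mathcomp Require Import all_boot all_algebra.
From mathcomp Require Import boolp classical_sets functions.

Set Implicit Arguments.
Unset Strict Implicit.
Unset Printing Implicit Defensive.

Import GRing.Theory.
Local Open Scope classical_set_scope.
Local Open Scope ring_scope.

(** * Principal ideals and the Jacobson radical *)

Lemma ideal_gen1P (R : comPzRingType) (a x : R) :
  ideal_gen [set a] x <-> exists b, x = b * a.
Proof.
split=> [agen_x|[b ->] I [[_ _ IM] Ia]]; last exact/IM/Ia.
apply: (agen_x [set x | exists b, x = b * a]); split; last first.
  by move=> _ ->; exists 1; rewrite mul1r.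
split=> [|_ _ [b ->] [c ->]|c _ [b ->]]; first by exists 0; rewrite mul0r.
  by exists (b + c); rewrite mulrDl.
by exists (c * b); rewrite mulrA.
Qed.

Lemma ideal_ext_gen1 (R S : comPzRingType) (f : {rmorphism R -> S})
    (I : ideal R) a :
  I = ideal_gen [set a] :> set R ->
  ideal_ext f I = ideal_gen [set f a] :> set S.
Proof.
move=> Ia; apply/seteqP; split=> y Iy J [J_ideal sJ]; apply: Iy; split=> //.
  move=> _ [x + <-]; rewrite Ia => /ideal_gen1P[b ->].
  by rewrite rmorphM; have [_ _ JM] := J_ideal; apply/JM/sJ.
move=> _ ->; apply: sJ; exists a => //.
by rewrite Ia; apply/ideal_gen1P; exists 1; rewrite mul1r.
Qed.

Lemma ideal_pow_gen1 (R : comPzRingType) (a : R) n :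
  ideal_pow (ideal_gen [set a]) n = ideal_gen [set a ^+ n] :> set R.
Proof.
apply/seteqP; elim: n => [|n [IHl IHr]]; split=> x.
- by move=> _; apply/ideal_gen1P; exists x; rewrite mulr1.
- by move=> _; apply: sub_gen_smallest.
- move=> Ix; apply: (Ix); split; first exact: smallest_is_ideal.
  move=> _ [_ /ideal_gen1P[b ->] [z /IHl/ideal_gen1P[c ->] <-]].
  by apply/ideal_gen1P; exists (b * c); rewrite exprS mulrACA.
- case/ideal_gen1P=> b ->.
  have [_ _ IM] := idealP (ideal_pow (ideal_gen [set a]) n.+1); apply: IM.
  apply: sub_gen_smallest; exists a; first exact: sub_gen_smallest.
  exists (a ^+ n); last by rewrite exprS.
  by apply: IHr; apply: sub_gen_smallest.
Qed.

Lemma sub_jacobson (R : comPzRingType) (x : R) :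
  (forall a, exists b, b * (1 - a * x) = 1) -> jacobson x.
Proof.
move=> x_unit M [M_proper M_max].
have [M0 MD MM] := idealP M.
(* The ideal [M + (x)] is either [M], which then contains [x], or contains [1 = m + a * x], which
   puts the unit [1 - a * x = m] in [M]. *)
have J_ideal : is_ideal [set z | exists m a, M m /\ z = m + a * x].
  split=> [|_ _ [m [a [Mm ->]]] [n [b [Mn ->]]]|c _ [m [a [Mm ->]]]].
  - by exists 0, 0; rewrite mul0r addr0.
  - by exists (m + n), (a + b); rewrite mulrDl addrACA; split=> //; exact: MD.
  - by exists (c * m), (c * a); rewrite mulrDr mulrA; split=> //; exact: MM.
have [z Mz /=|JM|JT] := M_max (Ideal J_ideal).
- by exists z, 0; rewrite mul0r addr0.
- by rewrite -JM /=; exists 0, 1; rewrite mul1r add0r.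
have : [set: R] 1 by [].
rewrite -JT /= => -[m [a [Mm m_ax]]].
case: M_proper; apply/seteqP; split=> // y _.
have [b b_inv] := x_unit a.
rewrite -[y]mulr1 -b_inv m_ax addrK; exact/MM/MM.
Qed.

(** * Lifting, inversion and division in inverse limits *)

Section InverseLimit.
Variables (S : nat -> comPzRingType) (F : forall i, {rmorphism S i.+1 -> S i}).
Implicit Types a b : invlim F.

Lemma lim_exprE a n i : lim_seq (a ^+ n) i = a i ^+ n.
Proof. exact: (rmorphXn (lim_proj (F := F) i)). Qed.

Hypothesis F_surj : forall i y, exists x, F i x = y.

Lemma lim_proj_surj i (y : S i) : exists a : invlim F, a i = y.
Proof.
elim: i S F F_surj y => [|i IHi] S' F' F'_surj y.
  pose next n z := projT1 (cid (F'_surj n z)).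
  have nextP n z : F' n (next n z) = z by rewrite /next; case: cid.
  pose a := fix a n : S' n := if n is m.+1 then next m (a m) else y.
  by exists (@InvLim S' F' a (fun n => nextP n (a n))).
have [a ay] := IHi (fun n => S' n.+1) (fun n => F' n.+1)
  (fun n => F'_surj n.+1) y.
pose b n : S' n := if n is m.+1 then a m else F' 0%N (a 0%N).
have bP n : F' n (b n.+1) = b n by case: n => //= n; exact: lim_seqP.
by exists (InvLim bP).
Qed.

(** Truncated geometric series invert each [1 - a i]; they are compatible, whatever the lengths
    [q i], because inverses are unique. *)
Lemma lim_nilp_inv a (q : nat -> nat) :
  (forall i, a i ^+ q i = 0) -> exists b, b * (1 - a) = 1.
Proof.
move=> a_nilp; pose s i := \sum_(k < q i) a i ^+ k.
have sP i : s i * (1 - a i) = 1.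
  by rewrite -[RHS]subr0 -(a_nilp i) -[1 - _ ^+ _]opprB subrX1 -mulNr opprB mulrC.
have bP i : F i (s i.+1) = s i.
  have uP : F i (s i.+1) * (1 - a i) = 1.
    by rewrite -(lim_seqP a) -[X in X - _](rmorph1 (F i)) -rmorphB -rmorphM sP rmorph1.
  by rewrite -[LHS]mulr1 -(sP i) mulrCA uP mulr1.
by exists (InvLim bP); apply: invlimP.
Qed.

(* Kernel elements expand as the [g]-adically convergent sums
   [\sum_n g ^+ (p ^ n) * w_n]: each coordinate of [g] is nilpotent, so that
   dividing by [g] gives sums which are finite in every coordinate. *)
Lemma lim_ker_principal p (g : invlim F) : (1 < p)%N ->
  (forall i, g i ^+ (p ^ i) = 0) ->
  (forall i x, F i x = 0 -> exists y, x = y * g i.+1 ^+ (p ^ i)) ->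
  forall x : invlim F, x 0%N = 0 -> exists y, x = y * g.
Proof.
move=> p_gt1 g_nilp kerF x x0.
(* The condition on [z] sits inside the existential so that choice gives a total [W]; the value 0 is
   a dummy. *)
have step n (z : invlim F) : exists w : invlim F,
    z n = 0 -> lim_seq (z - w * g ^+ (p ^ n)) n.+1 = 0.
  have [zn|] := EM (z n = 0); last by exists 0.
  have [y zy] : exists y, z n.+1 = y * g n.+1 ^+ (p ^ n).
    by apply: kerF; rewrite lim_seqP.
  have [w wy] := lim_proj_surj y.
  exists w => _; rewrite -[LHS]/(z n.+1 - w n.+1 * lim_seq (g ^+ (p ^ n)) n.+1).
  by rewrite lim_exprE wy zy subrr.
pose W n (z : invlim F) := projT1 (cid (step n z)).
have WP n (z : invlim F) : z n = 0 -> lim_seq (z - W n z * g ^+ (p ^ n)) n.+1 = 0.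
  by rewrite /W; case: cid.
(* Successive remainders: [r n] vanishes at coordinate [n]. *)
pose r := fix r n : invlim F := if n is m.+1 then r m - W m (r m) * g ^+ (p ^ m) else x.
have r0 n : r n n = 0 by elim: n => //= n; exact: WP.
pose s N : invlim F := \sum_(n < N) W n (r n) * g ^+ (p ^ n).-1.
have sg N : x - s N * g = r N.
  elim: N => [|N IHN]; first by rewrite /s big_ord0 mul0r subr0.
  rewrite /s big_ord_recr /= -/(s N) mulrDl opprD addrA IHN -mulrA -exprSr.
  by rewrite prednK ?expn_gt0 ?(ltnW p_gt1).
(* The new term carries [g i] to the power [p ^ i.+1 - 1 >= p ^ i], which is zero. *)
have sS i : s i.+2 i = s i.+1 i.
  rewrite /s big_ord_recr /=; set u := \sum_(n < _) _.
  rewrite -[LHS]/(lim_seq u i + W i.+1 (r i.+1) i * lim_seq (g ^+ (p ^ i.+1).-1) i).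
  have /subnK <- : (p ^ i <= (p ^ i.+1).-1)%N.
    by rewrite -ltnS prednK ?expn_gt0 ?(ltnW p_gt1) // ltn_exp2l.
  by rewrite lim_exprE exprD g_nilp !mulr0 addr0.
(* Coordinate [i] keeps the term [n = i], whose exponent [p ^ i - 1] is just below the nilpotency
   bound. *)
have yP i : F i (s i.+2 i.+1) = s i.+1 i by rewrite lim_seqP sS.
exists (InvLim yP); apply: invlimP => i.
apply: subr0_eq.
rewrite -[LHS]/(lim_seq (x - s i.+1 * g) i) sg -lim_seqP r0.
exact: rmorph0.
Qed.

End InverseLimit.

(** * Reductions modulo the base ideal *)

Section TowerBar.
Variables (T : tower) (I0 : ideal (T 0%N)) (i : nat).

Lemma tower_map_barE x :
  tower_map_bar I0 i (tower_pi I0 i x) = tower_pi I0 i.+1 (tower_map T i x).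
Proof. exact: quo_mapE. Qed.

Lemma tower_pi_surj u : exists x, tower_pi I0 i x = u.
Proof. by exists (quo_repr u); exact: quo_reprK. Qed.

Lemma tower_pi_eq0 x : tower_pi I0 i x = 0 <-> tower_ideal I0 i x.
Proof.
rewrite -[x in tower_ideal _ _ x]subr0 -(rmorph0 (tower_pi I0 i)).
exact: quo_piP.
Qed.

End TowerBar.

(** * The limit tower of a system in which Frobenius is [t] after [F] *)

Section PerfectTower.
Variables (p : nat) (p_pr : prime p) (S : nat -> comPzRingType).
Variables (t : forall i, {rmorphism S i -> S i.+1}).
Variables (F : forall i, {rmorphism S i.+1 -> S i}).
Hypothesis p0 : p%:R = 0 :> S 0%N.
Hypothesis tF : forall i x, t i (F i x) = x ^+ p.
Hypothesis Ft : forall i x, F i.+1 (t i.+1 x) = t i (F i x).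
Hypothesis t_inj : forall i, injective (t i).
Hypothesis F_surj : forall i y, exists x, F i x = y.

Let L j : comPzRingType := invlim (down_from F j).
Let tL j : {rmorphism L j -> L j.+1} := lim_map (from_comm Ft (j := j)).
Let TL : tower := Tower tL.

Let p_gt1 : (1 < p)%N. Proof. exact: prime_gt1. Qed.

Lemma up_fromK j i x : up_from t j i (down_from F j i x) = x ^+ p.
Proof. by elim: j i x => [|j IHj] i x; [exact: tF | exact: IHj]. Qed.

Lemma up_from_inj j i : injective (up_from t j i).
Proof. by elim: j i => [|j IHj] i; [exact: t_inj | exact: IHj]. Qed.

Lemma down_from_surj j i y : exists x, down_from F j i x = y.
Proof. by elim: j i y => [|j IHj] i y; [exact: F_surj | exact: IHj]. Qed.

Definition lim_shift j (a : L j) : L j.+1 :=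
  @InvLim _ (down_from F j.+1) (fun i => a i.+1) (fun i => lim_seqP a i.+1).

Definition lim_unshift_seq j (b : L j.+1) i : S (NatTrec.add j i) :=
  match i with 0 => down_from F j 0 (b 0%N) | i'.+1 => b i' end.

Lemma lim_unshift_seqP j b i :
  down_from F j i (lim_unshift_seq b i.+1) = lim_unshift_seq b i.
Proof. by case: i => //= i; exact: (lim_seqP b). Qed.

Definition lim_unshift j (b : L j.+1) : L j := InvLim (lim_unshift_seqP b).

Lemma lim_shiftK j : cancel (@lim_shift j) (@lim_unshift j).
Proof. by move=> a; apply: invlimP => -[|i] //=; exact: lim_seqP. Qed.

Lemma lim_unshiftK j : cancel (@lim_unshift j) (@lim_shift j).
Proof. by move=> b; apply: invlimP. Qed.

Lemma lim_shiftM j : {morph @lim_shift j : a b / a * b}.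
Proof. by move=> a b; apply: invlimP. Qed.

Lemma lim_shift0 j : lim_shift (0 : L j) = 0.
Proof. exact: invlimP. Qed.

Lemma lim_shift_map j a : lim_shift (tL j a) = tL j.+1 (lim_shift a).
Proof. exact: invlimP. Qed.

(** Compatibility gives [a i = F (a i.+1)], and [t] after [F] is the [p]-th power. *)
Lemma lim_shiftX j (a : L j) : lim_shift a ^+ p = tL j a.
Proof.
apply: invlimP => i; rewrite lim_exprE -[RHS]/(up_from t j i (a i)).
by rewrite -(lim_seqP a i) up_fromK.
Qed.

Lemma lim_map_unshift j b : tL j (lim_unshift b) = b ^+ p.
Proof. by rewrite -lim_shiftX lim_unshiftK. Qed.

Lemma lim_map_inj j : injective (tL j).
Proof.
by move=> a b ab; apply: invlimP => i; apply: (@up_from_inj j i);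
  exact: (congr1 (fun c : L j.+1 => c i) ab).
Qed.

(** Up to the shift, Frobenius is the injective map [tL j]; the exponent may be raised to
    [p ^ n]. *)
Lemma lim_reduced j (a : L j) n : a ^+ n = 0 -> a = 0.
Proof.
have reduced_p (b : L j) : b ^+ p = 0 -> b = 0.
  move=> bp; apply: (@lim_map_inj j); rewrite rmorph0 -lim_shiftX.
  apply: invlimP => i; rewrite lim_exprE.
  by rewrite -[LHS]/(b i.+1 ^+ p) -lim_exprE bp.
move=> an; have {an} : a ^+ (p ^ n) = 0.
  by rewrite -(subnK (ltnW (ltn_expl n p_gt1))) exprD an mulr0.
by elim: n => // n IHn; rewrite expnSr exprM => /reduced_p/IHn.
Qed.

(** * Generators of the kernels of the zeroth projections *)

Variable g : L 0%N.
Hypothesis g0 : g 0%N = 0.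
Hypothesis kerF : forall i x, F i x = 0 -> exists y, x = y * g i.+1 ^+ (p ^ i).

Let h j : L j := base_map TL j g.
Let J : ideal (L 0%N) := ideal_ker (lim_proj (F := F) 0%N).

(** Iterated, this makes [h j] the [p ^ j]-th power of the [j]-fold shift of [g], which reduces
    nilpotency and kernels to level 0. *)
Lemma base_map_lim_shift j : h j.+1 = lim_shift (h j) ^+ p.
Proof. by rewrite lim_shiftX. Qed.

Lemma base_map_coord j i : h j.+1 i = h j i.+1 ^+ p.
Proof. by rewrite base_map_lim_shift lim_exprE. Qed.

Lemma base_map_nilp j i : h j i ^+ (p ^ i) = 0.
Proof.
elim: j i => [|j IHj] i; last by rewrite base_map_coord -exprM -expnS IHj.
elim: i => [|i IHi]; first by rewrite expr1 g0.
by rewrite expnS exprM -tF -rmorphXn (lim_seqP g) IHi rmorph0.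
Qed.

Lemma down_from_ker j i x :
  down_from F j i x = 0 -> exists y, x = y * h j i.+1 ^+ (p ^ i).
Proof.
elim: j i x => [|j IHj] i x; first exact: kerF.
by move=> /(IHj i.+1)[y ->]; exists y; rewrite base_map_coord -exprM expnS.
Qed.

Lemma lim_proj0_ker j (a : L j) : a 0%N = 0 <-> exists b, a = b * h j.
Proof.
split=> [|[b ->]].
  apply: (lim_ker_principal (@down_from_surj j) p_gt1 (base_map_nilp j)).
  exact: down_from_ker.
by rewrite -[LHS]/(b 0%N * h j 0%N) -[h j 0%N]expr1 base_map_nilp mulr0.
Qed.

Lemma lim_kerE : J = ideal_gen [set g] :> set (L 0%N).
Proof.
apply/seteqP; split=> a.
  by move=> /(lim_proj0_ker (j := 0)) ab; apply/ideal_gen1P.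
by move=> /ideal_gen1P ab; apply/(lim_proj0_ker (j := 0)).
Qed.

Lemma lim_idealE j : tower_ideal (T := TL) J j = ideal_gen [set h j] :> set (L j).
Proof. exact/ideal_ext_gen1/lim_kerE. Qed.

(** Both sides mean divisibility by [h j]; reductions of the limit tower can thus be tested at
    coordinate 0. *)
Lemma lim_idealP j (a : L j) : tower_ideal (T := TL) J j a <-> a 0%N = 0.
Proof. by rewrite lim_idealE ideal_gen1P; split=> /lim_proj0_ker. Qed.


(** * The axioms of a perfectoid tower *)

Lemma lim_purely_inseparable : purely_inseparable p TL J.
Proof.
split.
- by rewrite /J /= rmorph_nat.
- move=> i u v.
  have [[a <-] [b <-]] := (tower_pi_surj u, tower_pi_surj v).
  rewrite !tower_map_barE => /eqP; rewrite -subr_eq0 -rmorphB -rmorphB.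
  move=> /eqP/tower_pi_eq0/lim_idealP tab.
  apply/eqP; rewrite -subr_eq0 -rmorphB; apply/eqP/tower_pi_eq0/lim_idealP.
  by apply: (@up_from_inj i 0%N); rewrite rmorph0.
- move=> i _ [u _ <-]; have [b <-] := tower_pi_surj u.
  exists (tower_pi (T := TL) J i (lim_unshift b)) => //.
  by rewrite tower_map_barE [tower_map _ _ _]lim_map_unshift rmorphXn.
Qed.

(** The reduced tower map is injective and sends both sides to the class of [b ^+ p]. *)
Lemma lim_frob_projE (piT : purely_inseparable p TL J) j b :
  frob_proj p_pr piT j (tower_pi (T := TL) J j.+1 b) =
    tower_pi (T := TL) J j (lim_unshift b).
Proof.
apply: (pi_inj piT); rewrite frob_projP tower_map_barE -rmorphXn.
by rewrite [tower_map _ _ _]lim_map_unshift.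
Qed.

(** If a power of [h j] kills [m], then [m * h j] is nilpotent, hence zero in the reduced ring
    [L j]. *)
Lemma lim_torsionP j (m : L j) : tower_torsion (T := TL) J j m <-> m * h j = 0.
Proof.
split=> [tor_m|mh x].
  have [|n _ gnm] := tor_m g; first exact: g0.
  apply: (@lim_reduced j _ n.+1); rewrite exprMn exprSr (exprSr (h j)).
  by rewrite -mulrA (mulrA m) (mulrC m) -rmorphXn gnm mul0r mulr0.
rewrite lim_kerE => /ideal_gen1P[b ->]; exists 1%N => //.
by rewrite expr1 rmorphM -mulrA (mulrC _ m) [m * _]mh mulr0.
Qed.

(** As [h j.+1] is the [p]-th power of [lim_shift (h j)] and [L j.+1] is reduced, these two elements
    have the same annihilator. *)
Lemma lim_unshift_torsion j (m : L j.+1) :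
  m * h j.+1 = 0 <-> lim_unshift m * h j = 0.
Proof.
rewrite base_map_lim_shift; split=> [mh|mh].
  apply: (can_inj (@lim_shiftK j)); rewrite lim_shiftM lim_shift0 lim_unshiftK.
  apply: (@lim_reduced _ _ p).
  rewrite exprMn -[X in m ^+ X](prednK (prime_gt0 p_pr)) exprSr -mulrA mh.
  exact: mulr0.
have : lim_shift (lim_unshift m * h j) = 0 by rewrite mh lim_shift0.
rewrite lim_shiftM lim_unshiftK -(prednK (prime_gt0 p_pr)) exprS mulrA => ->.
exact: mul0r.
Qed.

Lemma lim_perfectoid : perfectoid p_pr TL J.
Proof.
have piT := lim_purely_inseparable.
exists piT.
- move=> i u _; have [a <-] := tower_pi_surj u.
  exists (tower_pi (T := TL) J i.+1 (lim_shift a)) => //.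
  by rewrite lim_frob_projE lim_shiftK.
- move=> i x /lim_idealP/lim_proj0_ker[c ->]; apply: sub_jacobson => b.
  (* A multiple of [h i] has nilpotent coordinates, with exponent [p ^ k] at [k]. *)
  apply: (@lim_nilp_inv _ _ _ (expn p)) => k.
  by rewrite -[LHS]/((b k * (c k * h i k)) ^+ _) !exprMn base_map_nilp !mulr0.
- by exists g; exact: lim_kerE.
(* The shift of [g] is a [p]-th root of [h 1], the generator of the ideal at level 1. *)
- pose g1 : TL 1%N := lim_shift g.
  exists (ideal_gen [set g1]); split.
  + by exists g1.
  + rewrite ideal_pow_gen1 lim_idealE; congr (ideal_set (ideal_gen [set _])).
    exact: lim_shiftX.
  + move=> i; have g1E : base_map (tower_tail TL) i g1 = lim_shift (h i).
      by rewrite /h; elim: i => //= i ->; rewrite lim_shift_map.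
    rewrite (@ideal_ext_gen1 _ _ _ _ g1) //= g1E.
    (* The class of [b] is in the kernel when [h i] divides [lim_unshift b], that is, when
       [lim_shift (h i)] divides [b]. *)
    apply/seteqP; split=> u.
      have [b <-] := tower_pi_surj (u : tower_bar (T := TL) J i.+1); rewrite /= lim_frob_projE.
      move=> /(tower_pi_eq0 (T := TL))/lim_idealP/lim_proj0_ker[c bh].
      apply/ideal_gen1P; exists (tower_pi (T := TL) J i.+1 (lim_shift c)).
      by rewrite -rmorphM -lim_shiftM -bh lim_unshiftK.
    move=> /ideal_gen1P[b ->]; rewrite /= rmorphM lim_frob_projE lim_shiftK.
    rewrite (_ : tower_pi _ _ _ = 0) ?mulr0 //.
    apply/tower_pi_eq0/lim_idealP/lim_proj0_ker.
    by exists 1; rewrite mul1r.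
- move=> i x m; rewrite lim_kerE => /ideal_gen1P[b ->] /lim_torsionP mh.
  by rewrite rmorphM -mulrA (mulrC _ m) [m * _]mh mulr0.
- move=> i; exists (@lim_unshift i); split; last by move=> m _; rewrite lim_frob_projE.
  split.
  + by move=> m /lim_torsionP/lim_unshift_torsion ?; apply/lim_torsionP.
  + by move=> a b _ _; apply: (can_inj (@lim_unshiftK i)).
  + move=> m /lim_torsionP mh; exists (lim_shift m); last exact: lim_shiftK.
    by apply/lim_torsionP/lim_unshift_torsion; rewrite lim_shiftK.
Qed.

End PerfectTower.

(** * The tilt as a limit tower over the reductions *)

Theorem proposition3p41 (p : nat) (p_pr : prime p) (T : tower)
    (I0 : ideal (T 0%N)) (perfT : perfectoid p_pr T I0) :
  perfectoid p_pr (tilt p_pr (perf_pi perfT))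
                  (tilt_ideal p_pr (perf_pi perfT)).
Proof.
have [I1 [[f I1f] _ kerI1]] := perf_I1 perfT.
set piT := perf_pi perfT in kerI1 *.
pose F := frob_proj p_pr piT.
have tF i x : tower_map_bar I0 i (F i x) = x ^+ p := frob_projP p_pr piT x.
have F_surj i y : exists x, F i x = y.
  by have [x _ xy] := @perf_surj _ _ _ _ perfT i y Logic.I; exists x.
have kerF i x : F i x = 0 <->
    exists y, x = y * tower_pi I0 i.+1 (base_map (tower_tail T) i f).
  have -> : (F i x = 0) = ideal_ker (F i) x by [].
  by rewrite kerI1 (ideal_ext_gen1 _ I1f) ideal_gen1P.
have [g g1] : exists g : invlim F, g 1%N = tower_pi I0 1%N f.
  exact: lim_proj_surj.
(* Since [g i.+2 ^+ p] is the image of [g i.+1], all these powers come from the class of [f]. *)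
have gf i : tower_pi I0 i.+1 (base_map (tower_tail T) i f) = g i.+1 ^+ (p ^ i).
  elim: i => [|i IHi]; first by rewrite expr1 g1.
  by rewrite expnS exprM -tF (lim_seqP g) -rmorphXn -IHi tower_map_barE.
have g0 : g 0%N = 0.
  by rewrite -(lim_seqP g); apply/kerF; exists 1; rewrite gf mul1r expr1.
have kerFg i x : F i x = 0 -> exists y, x = y * g i.+1 ^+ (p ^ i).
  by move=> /kerF; rewrite gf.
(* The tilt and its ideal are convertible to [TL] and [J] for the reductions. *)
exact: (lim_perfectoid p_pr (tower_bar_p piT 0) tF
  (@frob_proj_comm p p_pr T I0 piT) (pi_inj piT) F_surj g0 kerFg).
Qed.
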